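(* Let $G$ be a finite simple graph with maximum degree $\Delta(G)\le 3$. Then $\chi'_{s,l}(G)\leq 11$.
   Context: All graphs are finite and simple. A strong edge-coloring of a graph $G$ is a map $c$ from $E(G)$ to a set of colors such that $c(e_1)\neq c(e_2)$ whenever $e_1,e_2$ are two distinct edges that are either adjacent to each other (share an endpoint) or both adjacent to a common edge of $G$. Equivalently, each color class is an induced matching. A list assignment $L=\{L(e):e\in E(G)\}$ gives each edge $e$ a set $L(e)$ of available colors. $G$ is strongly $L$-edge-colorable if it has a strong edge-coloring $c$ with $c(e)\in L(e)$ for every $e\in E(G)$. For a positive integer $k$, $G$ is strongly $k$-edge-choosable if it is strongly $L$-edge-colorable for every $L$ with $|L(e)|\ge k$ for all $e\in E(G)$. The strong list-chromatic index $\chi'_{s,l}(G)$ is the minimum positive integer $k$ for which $G$ is strongly $k$-edge-choosable. *)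

(* Defs.v *)
From mathcomp Require Import all_boot.
From mathcomp Require Import boolp classical_sets functions cardinality.

Set Implicit Arguments.
Unset Strict Implicit.
Unset Printing Implicit Defensive.

Record sgraph := SGraph {
  vertex :> finType;
  adj : rel vertex;
  adj_sym : symmetric adj;
  adj_irrefl : irreflexive adj }.

Definition max_degree (G : sgraph) : nat :=
  \max_(x : G) #|[pred y | adj x y]|.

Definition edge_set (G : sgraph) : {set {set G}} :=
  [set [set p.1; p.2]%SET | p : G * G & adj p.1 p.2]%SET.

Definition edge (G : sgraph) : finType := {a : {set G} | a \in edge_set G}.

Definition edge_adj (G : sgraph) (a b : edge G) : bool :=
  (a != b) && (val a :&: val b != finset.set0)%SET.

Definition strong_edge_coloring (G : sgraph) (C : Type) (c : edge G -> C) :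
    Prop :=
  forall a b : edge G, a != b ->
    edge_adj a b || [exists d : edge G, edge_adj a d && edge_adj b d] ->
    c a <> c b.

(* The lists are arbitrary, possibly infinite, sets of colors. *)
Definition strongly_list_colorable (G : sgraph) (C : Type)
    (L : edge G -> set C) : Prop :=
  exists c : edge G -> C, strong_edge_coloring c /\ forall a, L a (c a).

(* [`I_k #<= L a] says that [L a] has at least [k] elements. *)
Definition strongly_choosable (G : sgraph) (k : nat) : Prop :=
  forall (C : Type) (L : edge G -> set C),
    (forall a, (`I_k #<= L a)%card) -> strongly_list_colorable L.

Lemma ex_strongly_choosable (G : sgraph) :
  exists k, (0 < k) && `[< strongly_choosable G k >].
Proof.
exists #|edge G|.+1; apply/andP; split=> //; apply/asboolP => C0 L0.
pose C : choiceType := {classic C0}.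
pose L : edge G -> set C := L0; rewrite -[L0]/L => cardL.
have /choice[f fP] : forall a, exists f : nat -> C,
    {in gtn #|edge G|.+1 &, injective f} /\
    forall i, i < #|edge G|.+1 -> L a (f i).
  move=> a; have /card_leP[f] := cardL a.
  exists (fun i => if insub i is Some j
                   then val (f (SigSub (mem_set (valP (j : 'I_#|edge G|.+1)) :
                          val j \in `I_#|edge G|.+1)))
                   else val (f (SigSub (mem_set (ltn0Sn #|edge G|) :
                          0 \in `I_#|edge G|.+1)))).
  split=> [i j ilt jlt|i ilt]; last by case: insubP => *; exact: set_valP.
  rewrite (insubT (fun i => i < _) ilt) (insubT (fun i => i < _) jlt).
  by move=> /val_inj /(@inj _ _ _ f) => /(_ (in_setT _) (in_setT _)) [].
have [c [cL c_inj]] : exists c : edge G -> C,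
    (forall a, L a (c a)) /\ {in enum (edge G) &, injective c}.
  have: size (enum (edge G)) <= #|edge G| by rewrite -cardE.
  elim: (enum _) (enum_uniq (edge G)) => [|a s IHs] /=.
    by exists (fun a => f a 0); split=> // a; apply: (fP a).2.
  move=> /andP[aNs us] ltsE; have [c [cL c_inj]] := IHs us (ltnW ltsE).
  have [i ilt fi] : exists2 i, i < #|edge G|.+1 & f a i \notin map c s.
    apply: contrapT => noi.
    have: size (map (f a) (iota 0 #|edge G|.+1)) <= size (map c s).
      apply: uniq_leq_size.
        rewrite map_inj_in_uniq ?iota_uniq // => i j.
        by rewrite !mem_iota; exact: (fP a).1.
      move=> _ /mapP[i + ->]; rewrite mem_iota => /= ilt.
      by apply: contrapT => /negP fi; apply: noi; exists i.
    by rewrite !size_map size_iota leqNgt (ltn_trans ltsE).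
  exists (fun b => if b == a then f a i else c b); split=> [b|b b'].
    by case: eqP => [->|_] //; apply: (fP a).2.
  rewrite !inE; case: (eqVneq b a) => [->|_]; case: (eqVneq b' a) => [->|_] //=.
  - by move=> _ b's E; move: fi; rewrite E map_f.
  - by move=> bs _ E; move: fi; rewrite -E map_f.
  - exact: c_inj.
exists c; split=> // a b /eqP ab _ cab; apply: ab.
by apply: c_inj => //; rewrite mem_enum.
Qed.

Definition strong_list_chromatic_index (G : sgraph) : nat :=
  ex_minn (ex_strongly_choosable G).

(* Main.v *)
Require Import Defs.
From mathcomp Require Import all_boot.
From mathcomp Require Import zify.
From mathcomp Require boolp cardinality.

Set Implicit Arguments.
Unset Strict Implicit.
Unset Printing Implicit Defensive.

(** An edge of a subcubic graph conflicts with at most twelve others, so a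
    greedy colouring from lists of size 11 is at most two colours short. The
    colouring is done one connected component at a time, towards a root [v].
    Edges are coloured by decreasing distance to [v]: if [e] has an endpoint
    [u] and [w] is a neighbour of [u] closer to [v], then all edges at [w]
    conflict with [e] and come later, so at most nine of the conflicting edges
    ([card_conflicts_star]) are coloured before [e]. This leaves room for one
    more, and that room is spent on choosing first the colours of a set [I]
    of pairwise non-conflicting edges, away from [v]: the edges at [w]
    conflict with one another, so only one of them can lie in [I]
    ([color_towards]).

    What remains are the edges [a1], [a2], [a3] at [v], in this order. The
    first still has two uncoloured conflicting edges and is free; [a2] must
    save one colour and [a3] two ([colorable_star3]). A colour is saved when
    the edge has fewer than twelve conflicts, or when two edges of [I] in
    conflict with it get the same colour, or one of them gets a colour outside
    its list. As the edges of [I] still have their full lists, of the same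
    size as the list of [a3], one of these two is always possible
    ([pair_saving], [triple_saving]): lists that have no common colour cannot
    all lie in the list of [a3].

    The root is chosen by the local structure. The edges at a vertex of degree
    at most 2 and the edges of a triangle have at most nine conflicts. The
    edges of a 4-cycle have at most eleven, and either it extends to a
    K_{2,3}, where two edges have at most ten, or some non-conflicting pair is
    in conflict with both [a2] and [a3] ([colorable_C4]). In a cubic graph of girth at least 5, the neighbours
    of any [v] carry three pairwise non-conflicting edges that avoid [v]
    ([colorable_girth5]), and [triple_saving] provides all the savings. *)

Lemma count_le_size (T : eqType) (P : pred T) (l s : seq T) :
  uniq l -> {in l, forall x, P x -> x \in s} -> count P l <= size s.
Proof.
move=> ul sub; rewrite -size_filter; apply: uniq_leq_size.
  exact: filter_uniq.
by move=> x; rewrite mem_filter => /andP[Px xl]; exact: sub.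
Qed.

(** * The conflict relation on edges *)

Section Conflicts.

Variable G : sgraph.
Implicit Types (x y u v w : G) (a b e f : {set G}) (D I S : {set {set G}}).

Definition nbr x : {set G} := [set y | adj x y].

Definition star x : {set {set G}} := [set e in edge_set G | x \in e].

(** Edges are handled as vertex sets, and the relation is phrased by distances
    between endpoints: on edges this is the relation forbidding equal colours
    in a strong edge-colouring. *)
Definition conf a b :=
  (a != b) && [exists x in a, [exists y in b, (x == y) || adj x y]].

Definition conflicts e : {set {set G}} := [set f in edge_set G | conf e f].

Lemma edgeP e :
  reflect (exists x y, adj x y /\ e = [set x; y]) (e \in edge_set G).
Proof.
apply: (iffP imsetP) => [[[x y] /= xy ->]|[x [y [xy ->]]]].
  by exists x, y; move: xy; rewrite inE.
by exists (x, y) => //; rewrite inE.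
Qed.

Lemma edge_in x y : adj x y -> [set x; y] \in edge_set G.
Proof. by move=> xy; apply/edgeP; exists x, y. Qed.

Lemma adj_neq x y : adj x y -> x != y.
Proof. by apply: contraTneq => ->; rewrite adj_irrefl. Qed.

Lemma set2C x y : [set x; y] = [set y; x].
Proof. by rewrite setUC. Qed.

Lemma starP x e :
  reflect (exists2 y, adj x y & e = [set x; y]) (e \in star x).
Proof.
rewrite inE; apply: (iffP andP) => [[/edgeP[p [q [pq ->]]]]|[y xy ->]].
  rewrite !inE => /orP[]/eqP->; first by exists q.
  by exists p; rewrite 1?adj_sym // set2C.
by rewrite edge_in // !inE eqxx.
Qed.

Lemma star_edge x y : adj x y -> [set x; y] \in star x.
Proof. by move=> xy; apply/starP; exists y. Qed.

Lemma confP a b :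
  reflect (a != b /\ exists x y, [/\ x \in a, y \in b & (x == y) || adj x y])
    (conf a b).
Proof.
apply: (iffP andP) => -[ab].
  by case/existsP=> x /andP[xa /existsP[y /andP[yb xy]]]; split => //; exists x, y.
case=> x [y [xa yb xy]]; split=> //; apply/existsP; exists x; rewrite xa.
by apply/existsP; exists y; rewrite yb.
Qed.

Lemma conf_sym a b : conf a b = conf b a.
Proof.
by apply/confP/confP => -[ab [x [y [xa yb xy]]]]; rewrite eq_sym; split=> //;
  exists y, x; rewrite eq_sym adj_sym.
Qed.

Lemma conf_star x a b : a \in star x -> b \in star x -> a != b -> conf a b.
Proof.
rewrite !inE => /andP[_ xa] /andP[_ xb] ab; apply/confP; split => //.
by exists x, x; rewrite eqxx.
Qed.

(** The vertices that carry the conflicts of the edge [u t]: every conflicting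
    edge has an endpoint among these at most four vertices, which gives the
    bound of twelve and, when they are adjacent or coincide, better ones. *)
Definition around u t : {set G} := (nbr u :\ t) :|: (nbr t :\ u).

Lemma conflicts_around u t :
  adj u t -> conflicts [set u; t] \subset \bigcup_(x in around u t) star x.
Proof.
move=> ut; apply/subsetP => b; rewrite inE => /andP[bE /confP[ne]].
have key p q y : adj p q -> [set p; q] != b -> y \in b -> (p == y) || adj p y ->
    b \in \bigcup_(x in around p q) star x.
  move=> pq nb' yb pyE.
  have [py|yNq] := boolP (adj p y && (y != q)).
    apply/bigcupP; exists y; first by rewrite !inE andbC py.
    by rewrite inE bE.
  have : b \in star p \/ b \in star q.
    move: pyE yNq; case: eqP => [->|_] /=; first by rewrite !inE yb bE; left.
    by move=> -> /=; rewrite negbK => /eqP<-; rewrite !inE yb bE; right.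
  case=> /starP[z pz Eb].
    apply/bigcupP; exists z; last by rewrite inE bE Eb !inE eqxx orbT.
    rewrite !inE pz andbT; apply/orP; left.
    by apply: contraNneq nb' => <-; rewrite Eb.
  apply/bigcupP; exists z; last by rewrite inE bE Eb !inE eqxx orbT.
  rewrite !inE pz andbT; apply/orP; right.
  by apply: contraNneq nb' => <-; rewrite Eb set2C.
case=> x [y [+ yb xy]]; rewrite !inE => /orP[]/eqP xE; subst x.
  exact: key xy.
have -> : around u t = around t u by rewrite /around setUC.
by apply: (key t u y); rewrite ?(adj_sym t u) ?(set2C t u).
Qed.

Lemma conf_around u t x b : adj u t -> x \in around u t ->
  b \in edge_set G -> x \in b -> b != [set u; t] -> b \in conflicts [set u; t].
Proof.
move=> ut xa bE xb ne; rewrite inE bE; apply/confP; rewrite eq_sym; split=> //.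
move: xa; rewrite !inE => /orP[]/andP[_ ax]; [exists u, x | exists t, x];
  by rewrite !inE eqxx ?orbT ax orbT.
Qed.

(** * Connected components *)

Definition comp v : {set {set G}} :=
  [set e in edge_set G | [exists x in e, connect (@adj G) v x]].

Lemma compP v e :
  reflect (e \in edge_set G /\ exists2 x, x \in e & connect (@adj G) v x)
    (e \in comp v).
Proof.
rewrite inE; apply: (iffP andP) => -[eE]; first by move/exists_inP.
by move=> H; split=> //; apply/exists_inP.
Qed.

Lemma connC : connect_sym (@adj G).
Proof. exact: sym_connect_sym (@adj_sym G). Qed.

Lemma star_comp v x : connect (@adj G) v x -> star x \subset comp v.
Proof.
move=> vx; apply/subsetP => e; rewrite inE => /andP[eE xe].
by apply/compP; split=> //; exists x.
Qed.

Lemma comp_eq v x : connect (@adj G) v x -> comp v = comp x.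
Proof.
move=> vx; apply/setP => e; rewrite !inE; congr andb.
by apply: eq_existsb => y; rewrite (same_connect connC vx).
Qed.

(** The distance of an edge is that of its nearest endpoint. The point of the
    last clause is that every edge at [w], not only [u w], is strictly closer
    to [v] than [e]. *)
Lemma edge_distance v : exists d : {set G} -> nat,
  (forall e, e \in star v -> d e = 0) /\
  (forall e, e \in comp v -> e \notin star v -> exists u w,
     [/\ u \in e, w \notin e, adj u w, connect (@adj G) v w &
         {in star w, forall f, d f < d e}]).
Proof.
pose P n e := [exists p : n.-tuple G, path (@adj G) v p && (last v p \in e)].
have /boolp.choice[d dP] : forall e, exists n,
    (e \in comp v -> P n e) /\ (forall m, P m e -> n <= m).
  move=> e; have [[n Pn]|nP] := boolp.pselect (exists n, P n e).
    have exP : exists n, P n e by exists n.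
    exists (ex_minn exP).
    by case: ex_minnP => m Pm min; split.
  exists 0; split=> // /compP[_ [x xe /connectP[p vp xE]]]; exfalso; apply: nP.
  exists (size p); apply/existsP; exists (in_tuple p) => /=.
  by rewrite vp -xE.
exists d; split=> [e|e ec eNs].
  rewrite inE => /andP[_ ve]; apply/eqP; rewrite -leqn0; apply: (dP e).2.
  by apply/existsP; exists (in_tuple [::]).
have /existsP[[p sp] /=] := (dP e).1 ec; move/eqP: sp.
case/lastP: p => [|p u] sp; last rewrite last_rcons rcons_path.
  by rewrite /= => ve; case/negP: eNs; move: ec; rewrite !inE ve => /andP[-> _].
case/andP=> /andP[vp wu] ue; exists u, (last v p); split=> //.
- apply/negP => we; have : d e <= size p.
    by apply: (dP e).2; apply/existsP; exists (in_tuple p); rewrite /= vp.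
  by rewrite -sp size_rcons ltnn.
- by rewrite adj_sym.
- by apply/connectP; exists p.
move=> f; rewrite inE => /andP[_ wf]; rewrite -sp size_rcons ltnS.
by apply: (dP f).2; apply/existsP; exists (in_tuple p); rewrite /= vp.
Qed.

(** * Subcubic counting *)

Hypothesis deg3 : forall x, #|nbr x| <= 3.

Lemma card_star x : #|star x| <= 3.
Proof.
apply: leq_trans (deg3 x); apply: leq_trans (leq_imset_card (fun y => [set x; y]) _).
apply: subset_leq_card; apply/subsetP => e /starP[y xy ->].
by apply: imset_f; rewrite inE.
Qed.

Lemma card_bigcup_star (A : {set G}) : #|\bigcup_(x in A) star x| <= 3 * #|A|.
Proof.
apply: leq_trans (_ : \sum_(x in A) 3 <= _); last by rewrite sum_nat_const mulnC.
elim/big_ind2: _ => [|m1 n1 m2 n2 h1 h2|x _]; first by rewrite cards0.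
  by apply: leq_trans (leq_card_setU _ _) _; exact: leq_add.
exact: card_star.
Qed.

Lemma card_nbrD u t : adj u t -> #|nbr u :\ t| <= 2.
Proof. by move=> ut; have := cardsD1 t (nbr u); rewrite inE ut; have := deg3 u; lia. Qed.

Lemma card_around u t : adj u t -> #|around u t| <= 4.
Proof.
move=> ut; apply: leq_trans (leq_card_setU _ _) _.
by have := card_nbrD ut; have := @card_nbrD t u; rewrite adj_sym => /(_ ut); lia.
Qed.

Lemma card_conflicts_around u t : adj u t -> #|conflicts [set u; t]| <= 3 * #|around u t|.
Proof.
by move=> ut; apply: leq_trans (card_bigcup_star _); apply/subset_leq_card/conflicts_around.
Qed.

Lemma card_conflicts e : e \in edge_set G -> #|conflicts e| <= 12.
Proof.
case/edgeP=> u [t [ut ->]]; apply: leq_trans (card_conflicts_around ut) _.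
by have := card_around ut; lia.
Qed.

(** The conflicts of [e] live at four vertices, each with at most three edges,
    and [w] is one of the four. *)
Lemma card_conflicts_star e u w : e \in edge_set G -> u \in e -> w \notin e -> adj u w ->
  #|conflicts e :\: star w| <= 9.
Proof.
move=> eE ue wNe uw; have /starP[t ut eD] : e \in star u by rewrite inE eE.
have wa : w \in around u t.
  rewrite !inE uw andbT; apply/orP; left; apply: contraNneq wNe => ->.
  by rewrite eD !inE eqxx orbT.
apply: leq_trans (_ : 3 * #|around u t :\ w| <= _); last first.
  by have := cardsD1 w (around u t); rewrite wa; have := card_around ut; lia.
apply: leq_trans (card_bigcup_star _); apply: subset_leq_card.
apply/subsetP => b /setDP[]; rewrite eD => /(subsetP (conflicts_around ut)).
case/bigcupP=> x xa bx bw; apply/bigcupP; exists x => //.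
by rewrite in_setD1 xa andbT; apply: contraNneq bw => <-.
Qed.


(** * Extending partial colorings *)

Variables (C : eqType) (x0 : C) (L : {set G} -> seq C).
Hypothesis L_uniq : forall e, e \in edge_set G -> uniq (L e).
Hypothesis L_size : forall e, e \in edge_set G -> size (L e) = 11.

Definition proper_on (c : {set G} -> C) D :=
  {in D, forall a, c a \in L a} /\ {in D &, forall a b, conf a b -> c a != c b}.

Definition colorable v := exists c, proper_on c (comp v).

(** The number of colours that the edge [e] can no longer use because of [S].
    Counting in the list of [e], and not the colours on [S], makes colours
    outside that list free. *)
Definition lost (c : {set G} -> C) S e :=
  count [in [seq c b | b in S]] (L e).

Lemma eq_lost c c' S e : {in S, c =1 c'} -> lost c S e = lost c' S e.
Proof.
move=> cc'; rewrite /lost; suff -> : [seq c b | b in S] = [seq c' b | b in S] by [].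
by apply/eq_in_map => b; rewrite mem_enum; exact: cc'.
Qed.

Lemma lost_card c S e : e \in edge_set G -> lost c S e <= #|S|.
Proof.
move=> eE; rewrite cardE -(size_map c); apply: count_le_size => //.
exact: L_uniq.
Qed.

Lemma lost_setD c S I e :
  e \in edge_set G -> lost c S e <= #|S :\: I| + lost c I e.
Proof.
move=> eE; apply: leq_trans (leq_add (lost_card c (S :\: I) eE) (leqnn _)).
rewrite /lost -count_predUI; apply: leq_trans (leq_addr _ _).
apply: sub_count => x /imageP[b bS ->] /=.
have [bI|bNI] := boolP (b \in I); apply/orP; [right | left];
  by apply: image_f; rewrite // in_setD bNI.
Qed.

Lemma color_one c D e : e \in edge_set G -> D \subset edge_set G -> e \notin D ->
    proper_on c D -> lost c (conflicts e :&: D) e <= 10 ->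
  exists2 c', proper_on c' (e |: D) & {in D, c' =1 c}.
Proof.
move=> eE DE eND [cL cP] le10.
have [x xL xN] : exists2 x, x \in L e & x \notin [seq c b | b in conflicts e :&: D].
  have := count_predC [in [seq c b | b in conflicts e :&: D]] (L e).
  rewrite L_size // -/(lost _ _ _) => cnt.
  have : has (predC [in [seq c b | b in conflicts e :&: D]]) (L e).
    by rewrite has_count; lia.
  by case/hasP=> x xL /= xN; exists x.
have nex b : b \in D -> conf e b -> x != c b.
  move=> bD eb; apply: contraNneq xN => ->; apply: image_f.
  by rewrite !inE bD eb (subsetP DE).
exists (fun b => if b == e then x else c b); last first.
  by move=> b bD; case: eqP => // be; rewrite -be bD in eND.
split=> [b|a b].
  by rewrite in_setU1; case: (eqVneq b e) => [->|_] //= /cL.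
rewrite !in_setU1; case: (eqVneq a e) => [->|_]; case: (eqVneq b e) => [->|_] //=.
- by move=> _ _ /confP[]; rewrite eqxx.
- by move=> _; exact: nex.
- by move=> aD _; rewrite conf_sym eq_sym; exact: nex.
- exact: cP.
Qed.

Definition independent I := {in I &, forall a b, ~~ conf a b}.

(** The induction adds a farthest uncoloured edge [e]; the invariant is that
    coloured edges closer to [v] than an uncoloured one belong to [I]. The
    edges at [w], one step closer than [e], are therefore uncoloured but for at
    most one. *)
Lemma color_towards v I c0 : I \subset comp v :\: star v -> independent I ->
    {in I, forall a, c0 a \in L a} ->
  exists2 c, proper_on c (comp v :\: star v) & {in I, c =1 c0}.
Proof.
move=> Iv indI c0L; have [d [d0 dP]] := edge_distance v.
suff H n D c : #|(comp v :\: star v) :\: D| = n ->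
    I \subset D -> D \subset comp v :\: star v -> proper_on c D -> {in I, c =1 c0} ->
    {in comp v & D, forall e f, e \notin D -> d f < d e -> f \in I} ->
  exists2 c, proper_on c (comp v :\: star v) & {in I, c =1 c0}.
  apply: (H _ I c0 erefl) => //.
  by split=> // a b aI bI ab; case/negP: (indI _ _ aI bI).
elim: n D c => [|n IH] D c cD ID Dv gc cc0 inv.
  exists c => //; suff -> : comp v :\: star v = D by [].
  by apply/eqP; rewrite eqEsubset Dv andbT -setD_eq0 -cards_eq0 cD.
have /card_gt0P[e0 e0D] : 0 < #|(comp v :\: star v) :\: D| by rewrite cD.
case: (arg_maxnP d e0D) => e /setDP[/setDP[ec eNs] eND] emax.
have eE : e \in edge_set G by case/compP: ec.
have DE : D \subset edge_set G.
  by apply: subset_trans Dv _; apply/subsetP => f /setDP[/compP[]].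
have [u [w [ue we uw vw dw]]] := dP e ec eNs.
(* The edges at [w] conflict pairwise, and [I] is independent. *)
have le1 : #|star w :&: I| <= 1.
  apply/card_le1_eqP => a b /setIP[aw aI] /setIP[bw bI]; apply/eqP.
  by apply: contraNT (indI _ _ aI bI) => ab; rewrite conf_sym; exact: conf_star bw aw ab.
have le10 : lost c (conflicts e :&: D) e <= 10.
  apply: leq_trans (lost_card _ _ eE) _.
  rewrite -(cardsID (star w)) addnC.
  apply: (@leq_add _ _ 9 1).
    apply: leq_trans (card_conflicts_star eE ue we uw).
    by apply/subset_leq_card/setSD/subsetIl.
  apply: leq_trans le1; apply/subset_leq_card/subsetP => f.
  case/setIP=> /setIP[_ fD] fw; rewrite in_setI fw.
  by apply: (inv e f) => //; exact: dw.
have [c' gc' c'c] := color_one eE DE eND gc le10.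
apply: (IH (e |: D) c') => //.
- have : e \in (comp v :\: star v) :\: D by rewrite !in_setD eND eNs.
  move=> eX; have := cardsD1 e ((comp v :\: star v) :\: D).
  rewrite eX cD add1n => -[->]; congr #|pred_of_set _|.
  by rewrite [RHS]setDDl (setUC D).
- exact: subset_trans ID (subsetUr _ _).
- by rewrite subUset Dv sub1set in_setD eNs ec.
- by move=> a aI; rewrite c'c ?cc0 //; exact: (subsetP ID).
move=> a f ac; rewrite !in_setU1 negb_or => fD /andP[ae aND] dfa.
case/orP: fD => [/eqP fe|fD]; last exact: (inv a f).
have aNs : a \notin star v by apply: contraTN dfa => /d0->.
have /emax : a \in (comp v :\: star v) :\: D by rewrite !in_setD aND aNs.
by rewrite -fe /= leqNgt dfa.
Qed.

Lemma colorable_low v : {in star v, forall e, #|conflicts e| <= 10} -> colorable v.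
Proof.
move=> low.
have [c gc _] : exists2 c, proper_on c (comp v :\: star v) & {in set0, c =1 fun=> x0}.
  by apply: color_towards => [|a b|a]; rewrite ?sub0set ?inE.
suff H (s : seq {set G}) : {subset s <= star v} ->
    exists c, proper_on c (comp v :\: star v :|: [set a in s]).
  have [|c' gc'] := H (enum (star v)); first by move=> e; rewrite mem_enum.
  exists c'; suff -> : comp v = comp v :\: star v :|: [set a in enum (star v)] by [].
  rewrite set_enum setUC; apply/setP => e; rewrite in_setU in_setD.
  have := subsetP (star_comp (connect0 _ v)) e.
  by case: (e \in star v) => // ->.
elim: s => [|e s IH] sub; first by exists c; rewrite (_ : [set a in [::]] = set0) ?setU0.
have [|c' gc'] := IH; first by move=> a sa; apply: sub; rewrite inE sa orbT.
set D := _ :|: _ in gc'; have ev : e \in star v by apply: sub; rewrite inE eqxx.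
have eE : e \in edge_set G by move: ev; rewrite inE => /andP[].
rewrite set_cons setUCA -/D.
have [eD|eND] := boolP (e \in D).
  by exists c'; rewrite (setUidPr _) ?sub1set.
have [||c'' gc'' _] := color_one eE _ eND gc'; last by exists c''.
  apply/subsetP => a /setUP[/setDP[/compP[] //]|]; rewrite inE => sa.
  by have : a \in star v by [apply: sub; rewrite inE sa orbT]; rewrite inE => /andP[].
apply: leq_trans (lost_card _ _ eE) _; apply: leq_trans (low e ev).
exact/subset_leq_card/subsetIl.
Qed.

(** The edges at [v] conflict with one another, which is why [a2] may count one
    unit more than [a3]: when its turn comes, [a3] is still uncoloured. *)
Lemma colorable_star3 v a1 a2 a3 I c0 :
    star v = [set a1; a2; a3] -> uniq [:: a1; a2; a3] ->
    I \subset comp v :\: star v -> independent I ->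
    {in I, forall a, c0 a \in L a} ->
    #|conflicts a2 :\: I| + lost c0 I a2 <= 11 ->
    #|conflicts a3 :\: I| + lost c0 I a3 <= 10 ->
  colorable v.
Proof.
move=> sv; rewrite /= !inE negb_or andbT => /andP[/andP[a12 a13] a23] Iv indI c0L le2 le3.
have [c gc cc0] := color_towards Iv indI c0L.
have s1 : a1 \in star v by rewrite sv !inE eqxx.
have s2 : a2 \in star v by rewrite sv !inE eqxx orbT.
have s3 : a3 \in star v by rewrite sv !inE eqxx !orbT.
have sE a : a \in star v -> a \in edge_set G by rewrite inE => /andP[].
have IN a : a \in star v -> a \notin I.
  by apply: contraL => /(subsetP Iv)/setDP[].
have nbI a b : a \in star v -> b \in star v -> a != b -> a \in conflicts b.
  by move=> av bv ab; rewrite inE sE // conf_sym (conf_star av bv).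
set D := comp v :\: star v in Iv gc.
have DE : D \subset edge_set G by apply/subsetP => e /setDP[/compP[]].
have DN a : a \in star v -> a \notin D by rewrite in_setD => ->.
have [|c1 gc1 c1c] := color_one (sE _ s1) DE (DN _ s1) gc.
  apply: leq_trans (lost_card _ _ (sE _ s1)) _.
  have n2 : a2 \in conflicts a1 by apply: nbI; rewrite // eq_sym.
  have n3 : a3 \in conflicts a1 :\ a2.
    by rewrite in_setD1 eq_sym a23; apply: nbI; rewrite // eq_sym.
  have := cardsD1 a2 (conflicts a1); have := cardsD1 a3 (conflicts a1 :\ a2); rewrite n2 n3.
  have := card_conflicts (sE _ s1).
  have : #|conflicts a1 :&: D| <= #|conflicts a1 :\ a2 :\ a3|.
    apply/subset_leq_card/subsetP => b /setIP[b1 bD]; rewrite !in_setD1 b1 andbT.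
    by apply/andP; split; apply: contraTneq bD => ->; exact: DN.
  move=> sub le12 E3 E2; apply: leq_trans sub _.
  by move: le12; rewrite E2 E3.
have D1E : a1 |: D \subset edge_set G by rewrite subUset DE sub1set sE.
have D1N : a2 \notin a1 |: D by rewrite in_setU1 negb_or eq_sym a12 DN.
have c1c0 : {in I, c1 =1 c0}.
  by move=> a aI; rewrite c1c ?cc0 //; exact: (subsetP Iv).
have [|c2 gc2 c2c] := color_one (sE _ s2) D1E D1N gc1.
  apply: leq_trans (lost_setD c1 _ I (sE _ s2)) _.
  rewrite (eq_lost _ c1c0).
  have n3 : a3 \in conflicts a2 :\: I by rewrite in_setD IN //; apply: nbI; rewrite // eq_sym.
  have := cardsD1 a3 (conflicts a2 :\: I); rewrite n3.
  have : #|(conflicts a2 :&: (a1 |: D)) :\: I| <= #|(conflicts a2 :\: I) :\ a3|.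
    apply/subset_leq_card/subsetP => b /setDP[/setIP[b2 bD] bI].
    rewrite in_setD1 in_setD b2 bI !andbT.
    apply: contraTneq bD => ->; rewrite in_setU1 negb_or eq_sym a13; exact: DN.
  move=> sub E3; rewrite -ltnS; apply: leq_trans le2; rewrite E3 add1n addSn ltnS.
  by rewrite leq_add2r.
have D2E : a2 |: (a1 |: D) \subset edge_set G by rewrite subUset D1E sub1set sE.
have D2N : a3 \notin a2 |: (a1 |: D).
  by rewrite !in_setU1 !negb_or eq_sym a23 eq_sym a13 DN.
have c2c0 : {in I, c2 =1 c0}.
  by move=> a aI; rewrite c2c ?c1c0 // in_setU1 (subsetP Iv) // orbT.
have [|c3 gc3 c3c] := color_one (sE _ s3) D2E D2N gc2.
  apply: leq_trans (lost_setD c2 _ I (sE _ s3)) _.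
  rewrite (eq_lost _ c2c0); apply: leq_trans le3; rewrite leq_add2r.
  exact/subset_leq_card/setSD/subsetIl.
exists c3; suff -> : comp v = a3 |: (a2 |: (a1 |: D)) by [].
apply/setP => e; rewrite !in_setU1 in_setD.
have := subsetP (star_comp (connect0 _ v)) e.
have -> : (e \in star v) = [|| e == a1, e == a2 | e == a3].
  by rewrite sv !inE orbA.
by case: (e == a1); case: (e == a2); case: (e == a3) => //= ->.
Qed.

Lemma connect_colorable v x : connect (@adj G) v x -> colorable x -> colorable v.
Proof. by rewrite /colorable => /comp_eq->. Qed.

(** * Saving colours *)

(** This makes arbitrary lists as good as a single palette for savings: two edges
    whose lists both equal that of a third can share a colour, and an edge whose
    list differs from it can avoid it. *)
Lemma eq_or_escape (s A : seq C) : uniq s -> size s = size A ->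
  s =i A \/ exists2 c, c \in s & c \notin A.
Proof.
move=> us sA; have [sub|/allPn[c cs cA]] := boolP (all [in A] s); last first.
  by right; exists c.
by left; have [] := uniq_min_size us (allP sub); rewrite sA.
Qed.

Lemma pair_saving (T1 T2 A : seq C) :
    uniq T1 -> uniq T2 -> uniq A -> size T1 = 11 -> size T2 = 11 -> size A = 11 ->
  exists c1 c2, [/\ c1 \in T1, c2 \in T2 & count [in [:: c1; c2]] A <= 1].
Proof.
move=> u1 u2 uA s1 s2 sA.
have [E1|[c1 c1T c1A]] := @eq_or_escape T1 A u1 (etrans s1 (esym sA)); last first.
  exists c1, (head c1 T2); split=> //; first by case: (T2) s2 => //= *; rewrite inE eqxx.
  apply: (count_le_size (s := [:: head c1 T2])) => // x xA; rewrite !inE.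
  by case/orP=> // /eqP xc; rewrite -xc xA in c1A.
have [E2|[c2 c2T c2A]] := @eq_or_escape T2 A u2 (etrans s2 (esym sA)); last first.
  exists (head c2 T1), c2; split=> //; first by case: (T1) s1 => //= *; rewrite inE eqxx.
  apply: (count_le_size (s := [:: head c2 T1])) => // x xA; rewrite !inE.
  by case/orP=> // /eqP xc; rewrite -xc xA in c2A.
case: A uA sA E1 E2 => // c A uA sA E1 E2.
exists c, c; rewrite E1 E2 !inE eqxx; split=> //.
by apply: (count_le_size (s := [:: c])) => // x _; rewrite !inE orbb.
Qed.

(** With two of the colours outside [A], the third one is free to save a colour
    for [B]: outside [B] when possible; else its list is [B], and it can repeat
    [c1], unless [c1] lies outside [B]. *)
Lemma two_escape (T3 A B : seq C) c1 c2 :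
    uniq T3 -> uniq A -> uniq B -> size T3 = 11 -> size B = 11 ->
    c1 \notin A -> c2 \notin A ->
  exists2 c3, c3 \in T3 & forall s : seq C, {subset s <= [:: c1; c2; c3]} ->
    count [in s] A <= 1 /\ count [in s] B <= 2.
Proof.
move=> u3 uA uB s3 sB c1A c2A.
have outA c3 (s : seq C) : {subset s <= [:: c1; c2; c3]} -> count [in s] A <= 1.
  move=> sub; apply: (count_le_size (s := [:: c3])) => // x xA /sub; rewrite !inE.
  by case/or3P => // /eqP xc; [move: c1A | move: c2A]; rewrite -xc xA.
have [E3|[c3 c3T c3B]] := @eq_or_escape T3 B u3 (etrans s3 (esym sB)); last first.
  exists c3 => // s sub; split; first exact: outA sub.
  apply: (count_le_size (s := [:: c1; c2])) => // x xB /sub; rewrite !inE.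
  by case/or3P => [->|->|/eqP xc] //; rewrite ?orbT // -xc xB in c3B *.
have [c1B|c1B] := boolP (c1 \in B).
  exists c1 => [|s sub]; first by rewrite E3.
  split; first exact: outA sub.
  apply: (count_le_size (s := [:: c1; c2])) => // x xB /sub; rewrite !inE.
  by case/or3P => ->; rewrite ?orbT.
exists (head c1 T3) => [|s sub]; first by case: (T3) s3 => //= *; rewrite inE eqxx.
split; first exact: outA sub.
apply: (count_le_size (s := [:: c2; head c1 T3])) => // x xB /sub; rewrite !inE.
by case/or3P => [/eqP xc|->|->]; rewrite ?orbT // -xc xB in c1B *.
Qed.

(** If two of the three lists differ from [A], choose their colours outside [A]
    and conclude by [two_escape]. Otherwise two lists equal [A] and share a
    colour; a third list different from [A] contributes a colour outside [A],
    and one equal to [A] repeats the shared colour. *)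
Lemma triple_saving (T1 T2 T3 A B : seq C) :
    uniq T1 -> uniq T2 -> uniq T3 -> uniq A -> uniq B ->
    size T1 = 11 -> size T2 = 11 -> size T3 = 11 -> size A = 11 -> size B = 11 ->
  exists c1 c2 c3, [/\ c1 \in T1, c2 \in T2, c3 \in T3 &
    forall s : seq C, {subset s <= [:: c1; c2; c3]} ->
    count [in s] A <= 1 /\ count [in s] B <= 2].
Proof.
move=> u1 u2 u3 uA uB s1 s2 s3 sA sB.
have dich T : uniq T -> size T = 11 -> T =i A \/ exists2 c, c \in T & c \notin A.
  by move=> uT sT; apply: eq_or_escape; rewrite ?sA.
have same c d (s : seq C) : {subset s <= [:: c; d]} -> d = c \/ d \notin A ->
    count [in s] A <= 1 /\ count [in s] B <= 2.
  move=> sub dA; split; last by apply: (count_le_size (s := [:: c; d])) => // x _ /sub.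
  apply: (count_le_size (s := [:: c])) => // x xA /sub; rewrite !inE.
  case/orP=> // /eqP xd; case: dA => [<-|]; first by rewrite xd.
  by rewrite -xd xA.
have [a aA] : exists d : C, d \in A by case: (A) sA => // d A' _; exists d; rewrite inE eqxx.
have [E1|[c1 c1T c1A]] := dich T1 u1 s1;
have [E2|[c2 c2T c2A]] := dich T2 u2 s2;
have [E3|[c3 c3T c3A]] := dich T3 u3 s3.
- exists a, a, a; rewrite E1 E2 E3; split=> // s sub; apply: (same a a); last by left.
  by move=> x /sub; rewrite !inE; do ?case: eqP.
- exists a, a, c3; rewrite E1 E2; split=> // s sub; apply: (same a c3); last by right.
  by move=> x /sub; rewrite !inE; do ?case: eqP.
- exists a, c2, a; rewrite E1 E3; split=> // s sub; apply: (same a c2); last by right.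
  by move=> x /sub; rewrite !inE; do ?case: eqP.
- have [c cT cP] := two_escape u1 uA uB s1 sB c2A c3A.
  exists c, c2, c3; split=> // s sub; apply: cP => x /sub.
  by rewrite !inE; do ?case: eqP.
- exists c1, a, a; rewrite E2 E3; split=> // s sub; apply: (same a c1); last by right.
  by move=> x /sub; rewrite !inE; do ?case: eqP.
- have [c cT cP] := two_escape u2 uA uB s2 sB c1A c3A.
  exists c1, c, c3; split=> // s sub; apply: cP => x /sub.
  by rewrite !inE; do ?case: eqP.
- have [c cT cP] := two_escape u3 uA uB s3 sB c1A c2A.
  by exists c1, c2, c; split.
- have [c cT cP] := two_escape u3 uA uB s3 sB c1A c2A.
  by exists c1, c2, c; split.
Qed.

Lemma star3_edges v a1 a2 a3 : star v = [set a1; a2; a3] ->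
  [/\ a1 \in edge_set G, a2 \in edge_set G & a3 \in edge_set G].
Proof.
move=> sv; have sub a : a \in star v -> a \in edge_set G by rewrite inE => /andP[].
by split; apply: sub; rewrite sv !inE eqxx ?orbT.
Qed.

Lemma colorable_unsaved v a1 a2 a3 :
    star v = [set a1; a2; a3] -> uniq [:: a1; a2; a3] ->
    #|conflicts a2| <= 11 -> #|conflicts a3| <= 10 -> colorable v.
Proof.
move=> sv ua le2 le3; have [_ a2E a3E] := star3_edges sv.
apply: (colorable_star3 (I := set0) (c0 := fun=> x0) sv ua).
- exact: sub0set.
- by move=> a b; rewrite inE.
- by move=> a; rewrite inE.
- rewrite setD0; apply: leq_trans (leq_add le2 (lost_card _ _ a2E)) _.
  by rewrite cards0.
- rewrite setD0; apply: leq_trans (leq_add le3 (lost_card _ _ a3E)) _.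
  by rewrite cards0.
Qed.

Lemma colorable_pair v a1 a2 a3 t1 t2 :
    star v = [set a1; a2; a3] -> uniq [:: a1; a2; a3] ->
    t1 != t2 -> ~~ conf t1 t2 ->
    [set t1; t2] \subset comp v :\: star v ->
    [set t1; t2] \subset conflicts a2 -> [set t1; t2] \subset conflicts a3 ->
    #|conflicts a2| <= 11 -> #|conflicts a3| <= 11 ->
  colorable v.
Proof.
move=> sv ua t12 nt Iv I2 I3 le2 le3; have [_ a2E a3E] := star3_edges sv.
set I := [set t1; t2] in Iv I2 I3.
have IE t : t \in I -> t \in edge_set G by move=> /(subsetP Iv)/setDP[/compP[]].
have [t1E t2E] : t1 \in edge_set G /\ t2 \in edge_set G.
  by split; apply: IE; rewrite !inE eqxx ?orbT.
have [c1 [c2 [c1L c2L sav]]] := pair_saving (L_uniq t1E) (L_uniq t2E) (L_uniq a3E)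
  (L_size t1E) (L_size t2E) (L_size a3E).
pose c t := if t == t1 then c1 else c2.
have cI : {subset [seq c t | t in I] <= [:: c1; c2]}.
  by move=> x /imageP[t _ ->]; rewrite /c; case: ifP; rewrite !inE eqxx ?orbT.
have cI2 : #|I| = 2 by rewrite cards2 t12.
have sz a : I \subset conflicts a -> #|conflicts a| = #|conflicts a :\: I| + 2.
  by move=> Ia; rewrite -(cardsID I) (setIidPr Ia) cI2 addnC.
apply: (colorable_star3 (I := I) (c0 := c) sv ua) => //.
- move=> s t; rewrite !inE.
  case/orP=> /eqP-> /orP[]/eqP-> //; try by rewrite /conf eqxx.
  by rewrite conf_sym.
- move=> t; rewrite !inE /c; case: eqP => [-> //|_] /= /eqP-> //.
- apply: leq_trans (leq_add (leqnn _) (lost_card _ _ a2E)) _.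
  by rewrite cI2 -sz.
- apply: (@leq_add _ _ 9 1); first by rewrite -(leq_add2r 2) -sz.
  by apply: leq_trans sav; apply: sub_count => x /= /cI.
Qed.

Lemma colorable_triple v a1 a2 a3 t1 t2 t3 :
    star v = [set a1; a2; a3] -> uniq [:: a1; a2; a3] ->
    uniq [:: t1; t2; t3] -> ~~ conf t1 t2 -> ~~ conf t1 t3 -> ~~ conf t2 t3 ->
    [set t1; t2; t3] \subset comp v :\: star v ->
    [set t1; t2; t3] \subset conflicts a2 -> [set t1; t2; t3] \subset conflicts a3 ->
  colorable v.
Proof.
move=> sv ua ut n12 n13 n23 Iv I2 I3; have [_ a2E a3E] := star3_edges sv.
set I := [set t1; t2; t3] in Iv I2 I3.
have IE t : t \in I -> t \in edge_set G by move=> /(subsetP Iv)/setDP[/compP[]].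
have [t1E t2E t3E] : [/\ t1 \in edge_set G, t2 \in edge_set G & t3 \in edge_set G].
  by split; apply: IE; rewrite !inE eqxx ?orbT.
have [c1 [c2 [c3 [c1L c2L c3L sav]]]] := triple_saving (L_uniq t1E) (L_uniq t2E)
  (L_uniq t3E) (L_uniq a3E) (L_uniq a2E) (L_size t1E) (L_size t2E) (L_size t3E)
  (L_size a3E) (L_size a2E).
pose c t := if t == t1 then c1 else if t == t2 then c2 else c3.
have /sav[sav3 sav2] : {subset [seq c t | t in I] <= [:: c1; c2; c3]}.
  move=> x /imageP[t _ ->]; rewrite /c; case: ifP => _; last case: ifP => _;
  by rewrite !inE eqxx ?orbT.
have cI3 : #|I| = 3.
  rewrite -[RHS]/(size [:: t1; t2; t3]) -(card_uniqP ut).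
  by apply: eq_card => t; rewrite !inE -orbA.
have sz a : a \in edge_set G -> I \subset conflicts a -> #|conflicts a :\: I| <= 9.
  move=> aE Ia; have := card_conflicts aE.
  by rewrite -(cardsID I) (setIidPr Ia) cI3 (@leq_add2l 3 _ 9).
apply: (colorable_star3 (I := I) (c0 := c) sv ua) => //.
- move=> s t; rewrite !inE -!orbA.
  by case/or3P=> /eqP-> /or3P[]/eqP-> //; rewrite 1?conf_sym // /conf eqxx.
- move: ut; rewrite /= !inE negb_or => /andP[/andP[t12 t13] /andP[t23 _]] t.
  by rewrite !inE /c -orbA; case: eqP => [-> //|_]; case: eqP => [-> //|_] /= /eqP->.
- exact: (@leq_add _ _ 9 2) (sz _ a2E I2) sav2.
- exact: (@leq_add _ _ 9 1) (sz _ a3E I3) sav3.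
Qed.

(** * Roots of small degree and in short cycles *)

Lemma nbrs3 v : #|nbr v| = 3 -> exists x y z, uniq [:: x; y; z] /\ nbr v = [set x; y; z].
Proof.
move=> c3; have us := enum_uniq (nbr v); have sz : size (enum (nbr v)) = 3 by rewrite -cardE.
case E : (enum (nbr v)) us sz => [|x [|y [|z []]]] // us _.
exists x, y, z; split=> //.
by apply/setP => t; rewrite -[LHS]mem_enum E !inE orbA.
Qed.

Lemma nbrs3_at v x : #|nbr v| = 3 -> adj v x ->
  exists y z, uniq [:: x; y; z] /\ nbr v = [set x; y; z].
Proof.
move=> c3 vx; have [p [q [r [u E]]]] := nbrs3 c3.
have : x \in nbr v by rewrite inE.
move: u; rewrite E !inE /= !inE !negb_or !andbT -orbA => /andP[/andP[pq pr] qr].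
case/or3P => /eqP->.
- by exists q, r; rewrite /= !inE !negb_or pq pr qr.
- by exists p, r; rewrite /= !inE !negb_or (eq_sym q p) pq pr qr (setUC [set q]).
- exists p, q; rewrite /= !inE !negb_or (eq_sym r p) (eq_sym r q) pq pr qr.
  by split=> //; rewrite [LHS]setUC setUA.
Qed.

Lemma nbrs3_at2 v x y : #|nbr v| = 3 -> adj v x -> adj v y -> x != y ->
  exists z, uniq [:: x; y; z] /\ nbr v = [set x; y; z].
Proof.
move=> c3 vx vy xy; have [p [q [u E]]] := nbrs3_at c3 vx.
have : y \in nbr v by rewrite inE.
rewrite E !inE eq_sym (negPf xy) /= => /orP[]/eqP->; first by exists q.
exists p; split; last by rewrite setUAC.
by move: u; rewrite /= !inE !negb_or (eq_sym q) andbC => /andP[/andP[-> _] /andP[-> ->]].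
Qed.

Lemma edge_inj v x y : adj v x -> adj v y -> [set v; x] = [set v; y] -> x = y.
Proof.
move=> vx vy E; have : x \in [set v; y] by rewrite -E !inE eqxx orbT.
by rewrite !inE eq_sym (negPf (adj_neq vx)) => /eqP.
Qed.

Lemma star3 v x y z : uniq [:: x; y; z] -> nbr v = [set x; y; z] ->
  star v = [set [set v; x]; [set v; y]; [set v; z]] /\
  uniq [:: [set v; x]; [set v; y]; [set v; z]].
Proof.
move=> u E.
have [vx vy vz] : [/\ adj v x, adj v y & adj v z].
  by split; rewrite -(in_set (adj v)) -/(nbr v) E !inE eqxx ?orbT.
split.
  apply/setP => e; apply/starP/idP => [[t vt ->]|].
    have : t \in nbr v by rewrite inE.
    by rewrite E !inE -!orbA => /or3P[]/eqP->; rewrite eqxx ?orbT.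
  by rewrite !inE -orbA => /or3P[]/eqP->; [exists x | exists y | exists z].
move: u; rewrite /= !inE !negb_or !andbT => /andP[/andP[xy xz] yz].
by rewrite -andbA; apply/and3P; split; apply/eqP => /edge_inj H;
  move: xy xz yz; rewrite H // eqxx.
Qed.

Lemma not_conf p q r s :
  [/\ p != r, ~~ adj p r, p != s & ~~ adj p s] ->
  [/\ q != r, ~~ adj q r, q != s & ~~ adj q s] -> ~~ conf [set p; q] [set r; s].
Proof.
move=> [h1 h2 h3 h4] [h5 h6 h7 h8]; apply/negP => /confP[_ [x [y [+ + H]]]].
rewrite !inE => /orP[]/eqP xE /orP[]/eqP yE; subst x y; move: H; apply/negP;
  by rewrite negb_or; apply/andP.
Qed.

Lemma around_l u t x : adj u x -> x != t -> x \in around u t.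
Proof. by rewrite !inE => -> ->. Qed.

Lemma around_r u t x : adj t x -> x != u -> x \in around u t.
Proof. by rewrite !inE => -> ->; rewrite orbT. Qed.

Lemma colorable_deg2 v : #|nbr v| < 3 -> colorable v.
Proof.
move=> dv; apply: colorable_low => e /starP[x vx ->].
have xv : adj x v by rewrite adj_sym.
have le1 : #|nbr v :\ x| <= 1.
  by move: dv; rewrite (cardsD1 x) inE vx add1n !ltnS.
apply: leq_trans (card_conflicts_around vx) _; apply: (@leq_trans (3 * 3)) => //.
rewrite leq_mul2l; apply: leq_trans (leq_card_setU _ _) _.
exact: leq_add le1 (card_nbrD xv).
Qed.

Lemma card_starU (A : {set {set G}}) x e :
  e \in A -> e \in star x -> #|A :|: star x| <= #|A| + 2.
Proof.
move=> eA ex; have := cardsUI A (star x).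
have : 0 < #|A :&: star x| by apply/card_gt0P; exists e; rewrite in_setI eA.
have := card_star x; lia.
Qed.

(** Each edge between two of the four vertices at which the conflicts live is
    counted twice by the general bound. *)
Lemma card_conflicts_short u t p q r s : adj u t ->
    around u t \subset [set p; q; r; s] -> adj p q ->
  #|conflicts [set u; t]| <= (if adj p r then 10 else 11).
Proof.
move=> ut sub pq.
apply: (@leq_trans #|star p :|: star q :|: star r :|: star s|).
  apply: subset_leq_card; apply: subset_trans (conflicts_around ut) _.
  apply/bigcupsP => x /(subsetP sub); rewrite !inE -!orbA.
  by case/or4P => /eqP->; apply/subsetP => e ex; rewrite !in_setU ex ?orbT.
have q5 : #|star p :|: star q| <= 5.
  apply: leq_trans (card_starU (e := [set p; q]) _ _) _; rewrite ?star_edge //.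
    by rewrite set2C star_edge // adj_sym.
  by rewrite (leq_add2r 2 _ 3) card_star.
have r8 : #|star p :|: star q :|: star r| <= (if adj p r then 7 else 8).
  case: ifP => [pr|_].
    apply: leq_trans (card_starU (e := [set p; r]) _ _) _.
    - by rewrite in_setU star_edge.
    - by rewrite set2C star_edge // adj_sym.
    by rewrite (leq_add2r 2 _ 5).
  by apply: leq_trans (leq_card_setU _ _) _; exact: leq_add q5 (card_star r).
apply: leq_trans (leq_card_setU _ _) _.
by case: ifP r8 => _ r8; exact: leq_add r8 (card_star s).
Qed.

(** The two edges [v x] and [v y] see their conflicts at three vertices only,
    since the third corner of the triangle is a common neighbour. *)
Lemma colorable_triangle v x y : #|nbr v| = 3 -> adj v x -> adj v y -> adj x y ->
  colorable v.
Proof.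
move=> c3 vx vy xy; have xNy := adj_neq xy.
have [z [u E]] := nbrs3_at2 c3 vx vy xNy.
have small s t : adj v s -> adj v t -> adj s t -> #|conflicts [set v; s]| <= 9.
  move=> vs vt st; apply: leq_trans (card_conflicts_around vs) _.
  have := cardsUI (nbr v :\ s) (nbr s :\ v).
  have : 0 < #|(nbr v :\ s) :&: (nbr s :\ v)|.
    apply/card_gt0P; exists t.
    by rewrite !inE vt st eq_sym (adj_neq st) eq_sym (adj_neq vt).
  rewrite -/(around v s); have := card_nbrD vs.
  by have := card_nbrD (_ : adj s v); rewrite adj_sym => /(_ vs); lia.
have [sv us] : star v = [set [set v; z]; [set v; y]; [set v; x]] /\
    uniq [:: [set v; z]; [set v; y]; [set v; x]].
  apply: star3.
    by move: u; rewrite -(rev_uniq [:: x; y; z]).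
  by rewrite E; apply/setP => t; rewrite !inE; do ?case: eqP.
apply: (colorable_unsaved sv us).
  by apply: leq_trans (small y x vy vx _) _; rewrite // adj_sym.
exact: leq_trans (small x y vx vy xy) _.
Qed.

Section Component.

Variable v0 : G.
Local Notation conn := (connect (@adj G) v0).
Hypothesis cubic : forall v, conn v -> #|nbr v| = 3.
Hypothesis notri : forall v x y, conn v -> adj v x -> adj v y -> ~~ adj x y.

Lemma connS v x : conn v -> adj v x -> conn x.
Proof. by move=> vc vx; apply: connect_trans vc (connect1 vx). Qed.

(** In a K_{2,3}, the edge [c1 c4] has its conflicts at [c2], [c3], [x] and one
    more vertex, and [c2] is adjacent to [c3] and [x]. *)
Lemma colorable_K23 c1 c2 c3 c4 x :
    conn c1 -> adj c1 c2 -> adj c1 c4 -> c2 != c4 ->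
    nbr c2 = [set c1; c3; x] -> nbr c4 = [set c1; c3; x] ->
  colorable c1.
Proof.
move=> k1 a12 a14 n24 N2 N4.
have [x1 [u N1]] := nbrs3_at2 (cubic k1) a12 a14 n24.
have [sv us] : star c1 = [set [set c1; x1]; [set c1; c2]; [set c1; c4]] /\
    uniq [:: [set c1; x1]; [set c1; c2]; [set c1; c4]].
  apply: star3; first by rewrite -(rot_uniq 1).
  by rewrite N1; apply/setP => t; rewrite !inE; do ?case: eqP.
have small s t : adj c1 s -> nbr c1 = [set s; t; x1] -> nbr s = [set c1; c3; x] ->
    nbr t = [set c1; c3; x] -> #|conflicts [set c1; s]| <= 10.
  move=> as1 E1 Es Et.
  have tc3 : adj t c3 by rewrite -(in_set (adj t)) -/(nbr t) Et !inE eqxx orbT.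
  have tx : adj t x by rewrite -(in_set (adj t)) -/(nbr t) Et !inE eqxx orbT.
  have := @card_conflicts_short c1 s t c3 x x1 as1 _ tc3; rewrite tx; apply.
  rewrite /around E1 Es; apply/subsetP => z; rewrite !inE.
  by do ?case: eqP.
apply: (colorable_unsaved sv us); last first.
  apply: (small c4 c2) => //; rewrite N1; apply/setP => t; rewrite !inE.
  by do ?case: eqP.
by apply: leq_trans (small c2 c4 _ _ _ _) _.
Qed.

(** The edges [x1 y] and [c2 c3] can conflict only through [y = x2], [y = x3]
    or [x1 = x3], and both conflict with the cycle edges at [c1], which see
    their conflicts at both ends of another cycle edge. *)
Lemma colorable_C4_pair c1 c2 c3 c4 x1 x2 x3 x4 y :
    conn c1 -> uniq [:: c2; c4; x1] -> uniq [:: c1; c3; x2] ->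
    nbr c1 = [set c2; c4; x1] -> nbr c2 = [set c1; c3; x2] ->
    nbr c3 = [set c2; c4; x3] -> nbr c4 = [set c1; c3; x4] ->
    x1 != x3 -> adj x1 y -> y != c1 -> y != x3 -> y != x2 ->
  colorable c1.
Proof.
move=> k1 u1 u2 N1 N2 N3 N4 n13 x1y yc1 yx3 yx2.
have inN v z : adj v z = (z \in nbr v) by rewrite inE.
have [a12 a14 a1x] : [/\ adj c1 c2, adj c1 c4 & adj c1 x1].
  by split; rewrite inN N1 !inE eqxx ?orbT.
have [a23 a43] : adj c2 c3 /\ adj c4 c3 by rewrite !inN N2 N4 !inE !eqxx ?orbT.
have [[n24 n2x n4x] n13c] : [/\ c2 != c4, c2 != x1 & c4 != x1] /\ c1 != c3.
  move: u1 u2; rewrite /= !inE !negb_or !andbT.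
  by move=> /andP[/andP[-> ->] ->] /andP[/andP[-> _] _].
have k2 := connS k1 a12.
have n1c3 : ~~ adj c1 c3 by apply: (@notri c2) => //; rewrite adj_sym.
have xc2 : ~~ adj x1 c2 by apply: (notri k1).
have xc4 : ~~ adj x1 c4 by apply: (notri k1).
have x1c3 : x1 != c3 by apply: contraNneq n1c3 => <-.
have xNc3 : ~~ adj x1 c3.
  by rewrite adj_sym inN N3 !inE !negb_or eq_sym n2x eq_sym n4x n13.
have yc2 : y != c2 by apply: contraNneq xc2 => <-.
have yc4 : y != c4 by apply: contraNneq xc4 => <-.
have yc3 : y != c3 by apply: contraNneq xNc3 => <-.
have yNc2 : ~~ adj y c2 by rewrite adj_sym inN N2 !inE !negb_or yc1 yc3 yx2.
have yNc3 : ~~ adj y c3 by rewrite adj_sym inN N3 !inE !negb_or yc2 yc4 yx3.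
have [sv us] : star c1 = [set [set c1; x1]; [set c1; c4]; [set c1; c2]] /\
    uniq [:: [set c1; x1]; [set c1; c4]; [set c1; c2]].
  apply: star3; first by move: u1; rewrite -(rev_uniq [:: c2; c4; x1]).
  by rewrite N1; apply/setP => t; rewrite !inE; do ?case: eqP.
have x1Nc2 : x1 != c2 by rewrite eq_sym.
have nt : ~~ conf [set x1; y] [set c2; c3] by apply: not_conf.
have c1x1 : c1 != x1 by exact: adj_neq.
have tN t u : t \in [set [set x1; y]; [set c2; c3]] -> t != [set c1; u].
  apply: contraTneq => ->; rewrite !inE negb_or; apply/andP; split;
  apply/eqP => /setP/(_ c1); rewrite !inE eqxx /=.
    by rewrite (negPf c1x1) eq_sym (negPf yc1).
  by rewrite (negPf (adj_neq a12)) (negPf n13c).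
have nbs u : adj c1 u -> x1 != u -> c2 \in around c1 u \/ c3 \in around c1 u ->
    [set [set x1; y]; [set c2; c3]] \subset conflicts [set c1; u].
  move=> a1u xu c23; apply/subsetP => t tI; have nt1 := tN t u tI.
  case/set2P: tI => tE; rewrite tE in nt1 *.
    by apply: (conf_around a1u (around_l a1x xu)); rewrite ?edge_in // !inE eqxx.
  by case: c23 => c23; apply: (conf_around a1u c23);
    rewrite ?edge_in // !inE eqxx ?orbT.
apply: (colorable_pair sv us (t1 := [set x1; y]) (t2 := [set c2; c3])) => //.
- apply/eqP => /setP/(_ c2); rewrite !inE eqxx eq_sym (negPf x1Nc2).
  by rewrite eq_sym (negPf yc2).
- apply/subsetP => t tI; rewrite in_setD; apply/andP; split.
    by apply/starP => -[z _ tE]; have := tN t z tI; rewrite tE eqxx.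
  case/set2P: tI => ->; apply/compP; rewrite edge_in //.
    split=> //; exists x1; first by rewrite !inE eqxx.
    exact: connect1.
  by split=> //; exists c2; [rewrite !inE eqxx | exact: connect1].
- by apply: nbs; rewrite // 1?eq_sym //; left; apply: around_l.
- by apply: nbs => //; right; apply: around_r; rewrite // eq_sym.
- apply: leq_trans (card_conflicts_short (p := c2) (q := c3) (r := x1) (s := x4) a14 _ a23) _.
    by rewrite /around N1 N4; apply/subsetP => z; rewrite !inE; do ?case: eqP.
  by case: ifP.
- apply: leq_trans (card_conflicts_short (p := c4) (q := c3) (r := x1) (s := x2) a12 _ a43) _.
    by rewrite /around N1 N2; apply/subsetP => z; rewrite !inE; do ?case: eqP.
  by case: ifP.
Qed.

(** A neighbour [y] of [x1] other than [c1] and [x3] cannot equal both [x2] and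
    [x4] unless [x2 = x4], which makes a K_{2,3}; so the previous lemma applies
    to the cycle in one of its two orientations. *)
Lemma colorable_C4 c1 c2 c3 c4 :
    conn c1 -> adj c1 c2 -> adj c2 c3 -> adj c3 c4 -> adj c4 c1 ->
    c1 != c3 -> c2 != c4 ->
  colorable v0.
Proof.
move=> k1 a12 a23 a34 a41 n13 n24.
have sym x y : adj x y -> adj y x by rewrite adj_sym.
have k2 := connS k1 a12; have k3 := connS k2 a23; have k4 := connS k3 a34.
have [x1 [u1 N1]] := nbrs3_at2 (cubic k1) a12 (sym _ _ a41) n24.
have [x2 [u2 N2]] := nbrs3_at2 (cubic k2) (sym _ _ a12) a23 n13.
have [x3 [u3 N3]] := nbrs3_at2 (cubic k3) (sym _ _ a23) a34 n24.
have [x4 [u4 N4]] := nbrs3_at2 (cubic k4) a41 (sym _ _ a34) n13.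
have [x24|n24x] := eqVneq x2 x4.
  apply: (connect_colorable k1); rewrite -x24 in N4.
  exact: colorable_K23 k1 a12 (sym _ _ a41) n24 N2 N4.
have [x13|n13x] := eqVneq x1 x3.
  apply: (connect_colorable k2); rewrite -x13 in N3.
  exact: colorable_K23 k2 (sym _ _ a12) a23 n13 N1 N3.
apply: (connect_colorable k1).
have a1x : adj c1 x1.
  have inN z : adj c1 z = (z \in nbr c1) by rewrite inE.
  by rewrite inN N1 !inE eqxx orbT.
have [p [q [u E]]] := nbrs3_at (cubic (connS k1 a1x)) (sym _ _ a1x).
have [y [x1y yc1 yx3]] : exists y, [/\ adj x1 y, y != c1 & y != x3].
  have [xp xq] : adj x1 p /\ adj x1 q.
    have inN z : adj x1 z = (z \in nbr x1) by rewrite inE.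
    by rewrite !inN E !inE !eqxx !orbT.
  move: u; rewrite /= !inE negb_or andbT => /andP[/andP[cp cq] pq].
  have [px|px] := eqVneq p x3; last by exists p; rewrite eq_sym cp.
  by exists q; rewrite (eq_sym q) cq -px eq_sym.
have [yx2|yx2] := eqVneq y x2; last first.
  exact: colorable_C4_pair k1 u1 u2 N1 N2 N3 N4 n13x x1y yc1 yx3 yx2.
have u1' : uniq [:: c4; c2; x1].
  move: u1; rewrite /= !inE !negb_or !andbT (eq_sym c4 c2).
  by case/andP=> /andP[-> ->] ->.
apply: (colorable_C4_pair k1 u1' u4 _ N4 _ N2 n13x x1y yc1 yx3 _).
- by rewrite N1 (setUC [set c2]).
- by rewrite N3 (setUC [set c2]).
- by rewrite yx2.
Qed.

(** * Girth at least five *)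

Hypothesis noC4 : forall v x u y, conn v -> adj v x -> adj x u -> adj u y ->
  adj y v -> v != u -> x = y.

Lemma colorable_girth5_triple x1 x2 x3 y1 y2 y3 :
    uniq [:: x1; x2; x3] -> nbr v0 = [set x1; x2; x3] ->
    adj x1 y1 -> y1 != v0 -> adj x2 y2 -> y2 != v0 -> adj x3 y3 -> y3 != v0 ->
    ~~ adj y1 y2 -> ~~ adj y1 y3 -> ~~ adj y2 y3 ->
  colorable v0.
Proof.
move=> ux N xy1 y1v xy2 y2v xy3 y3v ny12 ny13 ny23.
have sym x y : adj x y -> adj y x by rewrite adj_sym.
have k0 : conn v0 by exact: connect0.
have inN z : adj v0 z = (z \in nbr v0) by rewrite inE.
have [a1 a2 a3] : [/\ adj v0 x1, adj v0 x2 & adj v0 x3].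
  by split; rewrite inN N !inE eqxx ?orbT.
have nc p q y z : adj v0 p -> adj v0 q -> p != q -> adj p y -> adj q z ->
    y != v0 -> z != v0 -> ~~ adj y z -> ~~ conf [set p; y] [set q; z].
  move=> ap aq pq py qz yv zv yz.
  have pNq := notri k0 ap aq; have qNp := notri k0 aq ap.
  have pNz : ~~ adj p z.
    apply/negP => pz; move: pq; apply/negP; rewrite negbK; apply/eqP.
    by apply: (noC4 k0 ap pz (sym _ _ qz) (sym _ _ aq)); rewrite eq_sym.
  have yNq : ~~ adj y q.
    apply/negP => yq; move: pq; apply/negP; rewrite negbK; apply/eqP.
    by apply: (noC4 k0 ap py yq (sym _ _ aq)); rewrite eq_sym.
  apply: not_conf; split=> //.
  - by apply: contraNneq qNp => ->.
  - by apply: contraNneq pNq => <-.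
  - by apply: contraNneq yNq => ->; apply: sym.
have [n12 n13 n23] : [/\ x1 != x2, x1 != x3 & x2 != x3].
  by move: ux; rewrite /= !inE negb_or andbT => /andP[/andP[-> ->] ->].
have [sv us] := star3 ux N.
have ninv p y : adj v0 p -> y != v0 -> v0 \notin [set p; y].
  by move=> /adj_neq ap yv; rewrite !inE negb_or ap eq_sym.
have tne p q y z : adj v0 p -> adj v0 q -> adj q z -> p != q ->
    [set p; y] != [set q; z].
  move=> ap aq qz pq; apply/eqP => /setP/(_ p); rewrite !inE eqxx (negPf pq) /=.
  by case: eqP => // pz; have := notri k0 aq ap; rewrite pz qz.
have tnb p q y : adj v0 p -> adj v0 q -> adj p y -> y != v0 ->
    [set p; y] \in conflicts [set v0; q].
  move=> ap aq py yv.
  have ne : [set p; y] != [set v0; q].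
    by apply: contra (ninv p y ap yv) => /eqP->; rewrite !inE eqxx.
  have [pq|pq] := eqVneq p q.
    rewrite pq in py ne *; apply: (conf_around aq (around_r py yv)) => //.
      exact: edge_in.
    by rewrite !inE eqxx orbT.
  apply: (conf_around aq (around_l ap pq)) => //; first exact: edge_in.
  by rewrite !inE eqxx.
have tcomp p y : adj v0 p -> adj p y -> y != v0 -> [set p; y] \in comp v0 :\: star v0.
  move=> ap py yv; rewrite in_setD; apply/andP; split.
    by apply: contra (ninv p y ap yv); rewrite inE => /andP[].
  apply/compP; split; first exact: edge_in.
  by exists p; [rewrite !inE eqxx | exact: connect1].
have sub3 (A : {set {set G}}) t1 t2 t3 : t1 \in A -> t2 \in A -> t3 \in A ->
    [set t1; t2; t3] \subset A.
  by move=> ? ? ?; rewrite !subUset !sub1set; apply/andP; split=> //; apply/andP.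
apply: (colorable_triple sv us (t1 := [set x1; y1]) (t2 := [set x2; y2])
  (t3 := [set x3; y3])).
- by rewrite /= !inE negb_or !tne.
- exact: nc.
- exact: nc.
- exact: nc.
- by apply: sub3; apply: tcomp.
- by apply: sub3; apply: tnb.
- by apply: sub3; apply: tnb.
Qed.

(** With [y_i], [z_i] the neighbours of [x_i] beyond [v0], two edges [x_i y_i]
    and [x_j y_j] conflict only if [y_i] and [y_j] are adjacent. Excluding
    4-cycles makes these adjacencies a matching between any two of the three
    pairs. Completed to perfect matchings, they form a 6-cycle, which has an
    independent transversal, or two triangles; the latter are excluded, and a
    missing edge again gives an independent transversal. *)
Lemma colorable_girth5 : colorable v0.
Proof.
have sym x y : adj x y -> adj y x by rewrite adj_sym.
have k0 : conn v0 by exact: connect0.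
have [x1 [x2 [x3 [ux N]]]] := nbrs3 (cubic k0).
have inN v z : adj v z = (z \in nbr v) by rewrite inE.
have [a1 a2 a3] : [/\ adj v0 x1, adj v0 x2 & adj v0 x3].
  by split; rewrite inN N !inE eqxx ?orbT.
have others x : adj v0 x -> exists y z,
    [/\ adj x y, adj x z, y != z, y != v0 & z != v0].
  move=> vx; have [y [z [u E]]] := nbrs3_at (cubic (connS k0 vx)) (sym _ _ vx).
  exists y, z; rewrite !inN E !inE !eqxx !orbT; move: u; rewrite /= !inE negb_or andbT.
  by rewrite (eq_sym y v0) (eq_sym z v0) => /andP[/andP[-> ->] ->].
have [y1 [z1 [xy1 xz1 yz1 y1v z1v]]] := others x1 a1.
have [y2 [z2 [xy2 xz2 yz2 y2v z2v]]] := others x2 a2.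
have [y3 [z3 [xy3 xz3 yz3 y3v z3v]]] := others x3 a3.
have one p q x y z : adj v0 q -> adj q p -> adj v0 x -> adj x y -> adj x z ->
    y != z -> ~~ (adj p y && adj p z).
  move=> vq qp vx xy xz yz; apply/negP => /andP[py pz]; move: yz; apply/negP.
  rewrite negbK; apply/eqP.
  apply: (noC4 (connS k0 vx) xy (sym _ _ py) pz (sym _ _ xz)).
  by apply: contraTneq qp => <-; exact: notri k0 vq vx.
have tri p q r x : adj v0 x -> adj x p -> ~~ [&& adj p q, adj p r & adj q r].
  move=> vx xp; apply/negP => /and3P[pq pr].
  by apply/negP; exact: notri (connS (connS k0 vx) xp) pq pr.
have [//|nc] := boolp.pselect (colorable v0).
have T p q r : adj x1 p -> p != v0 -> adj x2 q -> q != v0 -> adj x3 r -> r != v0 ->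
    [|| adj p q, adj p r | adj q r].
  move=> h1 h2 h3 h4 h5 h6; apply/negPn/negP; rewrite !negb_or => /and3P[*].
  by apply: nc; apply: (colorable_girth5_triple ux N (y1 := p) (y2 := q) (y3 := r)).
have := T _ _ _ xy1 y1v xy2 y2v xy3 y3v; have := T _ _ _ xy1 y1v xy2 y2v xz3 z3v.
have := T _ _ _ xy1 y1v xz2 z2v xy3 y3v; have := T _ _ _ xy1 y1v xz2 z2v xz3 z3v.
have := T _ _ _ xz1 z1v xy2 y2v xy3 y3v; have := T _ _ _ xz1 z1v xy2 y2v xz3 z3v.
have := T _ _ _ xz1 z1v xz2 z2v xy3 y3v; have := T _ _ _ xz1 z1v xz2 z2v xz3 z3v.
have := one _ _ _ _ _ a1 xy1 a2 xy2 xz2 yz2; have := one _ _ _ _ _ a1 xz1 a2 xy2 xz2 yz2.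
have := one _ _ _ _ _ a1 xy1 a3 xy3 xz3 yz3; have := one _ _ _ _ _ a1 xz1 a3 xy3 xz3 yz3.
have := one _ _ _ _ _ a2 xy2 a3 xy3 xz3 yz3; have := one _ _ _ _ _ a2 xz2 a3 xy3 xz3 yz3.
have := one _ _ _ _ _ a2 xy2 a1 xy1 xz1 yz1; have := one _ _ _ _ _ a2 xz2 a1 xy1 xz1 yz1.
have := one _ _ _ _ _ a3 xy3 a1 xy1 xz1 yz1; have := one _ _ _ _ _ a3 xz3 a1 xy1 xz1 yz1.
have := one _ _ _ _ _ a3 xy3 a2 xy2 xz2 yz2; have := one _ _ _ _ _ a3 xz3 a2 xy2 xz2 yz2.
have := tri _ y2 y3 _ a1 xy1; have := tri _ y2 z3 _ a1 xy1.
have := tri _ z2 y3 _ a1 xy1; have := tri _ z2 z3 _ a1 xy1.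
have := tri _ y2 y3 _ a1 xz1; have := tri _ y2 z3 _ a1 xz1.
have := tri _ z2 y3 _ a1 xz1; have := tri _ z2 z3 _ a1 xz1.
rewrite (adj_sym y2 y1) (adj_sym y2 z1) (adj_sym z2 y1) (adj_sym z2 z1).
rewrite (adj_sym y3 y1) (adj_sym y3 z1) (adj_sym z3 y1) (adj_sym z3 z1).
rewrite (adj_sym y3 y2) (adj_sym y3 z2) (adj_sym z3 y2) (adj_sym z3 z2).
(* A propositional contradiction in the twelve possible adjacencies. *)
case: (adj y1 y2) => /=; case: (adj y1 z2) => //=; case: (adj z1 y2) => //=;
case: (adj z1 z2) => //=; case: (adj y1 y3) => //=; case: (adj y1 z3) => //=;
case: (adj z1 y3) => //=; case: (adj z1 z3) => //=; case: (adj y2 y3) => //=;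
case: (adj y2 z3) => //=; case: (adj z2 y3) => //=; case: (adj z2 z3) => //=.
Qed.

End Component.

Lemma all_components_colorable v : colorable v.
Proof.
have sym x y : adj x y -> adj y x by rewrite adj_sym.
have [//|nc] := boolp.pselect (colorable v).
have nc' x : connect (@adj G) v x -> ~ colorable x.
  by move=> vx cx; apply: nc; apply: connect_colorable cx.
have cubic x : connect (@adj G) v x -> #|nbr x| = 3.
  move=> vx; apply/eqP; rewrite eqn_leq deg3 leqNgt; apply/negP => dx.
  exact: nc' vx (colorable_deg2 dx).
have notri u x y : connect (@adj G) v u -> adj u x -> adj u y -> ~~ adj x y.
  move=> vu ux uy; apply/negP => xy.
  exact: nc' vu (colorable_triangle (cubic u vu) ux uy xy).
apply: colorable_girth5 => // a b c d va ab bc cd da ac.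
have [//|bd] := eqVneq b d; case: nc.
exact: (colorable_C4 cubic notri va ab bc cd da ac bd).
Qed.

(** Conflicting edges lie in the same component, so the colourings of the
    components glue along the canonical root of each component. *)
Lemma strong_list_coloring : exists c, proper_on c (edge_set G).
Proof.
have /boolp.choice[F FP] := all_components_colorable.
pose c e := if [pick x in e] is Some x then F (root (@adj G) x) e else x0.
have conn2 e x y : e \in edge_set G -> x \in e -> y \in e -> connect (@adj G) x y.
  case/edgeP=> p [q [pq ->]]; rewrite !inE.
  have qp : adj q p by rewrite adj_sym.
  by case/orP=> /eqP-> /orP[]/eqP->; rewrite ?connect0 ?(connect1 pq) ?(connect1 qp).
have cE e x : e \in edge_set G -> x \in e -> c e = F (root (@adj G) x) e.
  move=> eE xe; rewrite /c; case: pickP => [y ye|/(_ x)]; last by rewrite xe.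
  by rewrite (rootP connC (conn2 e x y eE xe ye)).
have inC e x : e \in edge_set G -> x \in e -> e \in comp (root (@adj G) x).
  move=> eE xe; apply/compP; split=> //; exists x => //.
  by rewrite connC connect_root.
have ne e : e \in edge_set G -> exists x, x \in e.
  by case/edgeP=> p [q [_ ->]]; exists p; rewrite !inE eqxx.
exists c; split=> [e eE|a b aE bE ab].
  by have [x xe] := ne e eE; rewrite (cE e x) //; apply: (FP _).1; exact: inC.
have /confP[_ [x [y [xa yb xy]]]] := ab.
have rxy : root (@adj G) x = root (@adj G) y.
  by apply/(rootP connC); case/orP: xy => [/eqP->|/connect1].
rewrite (cE a x) // (cE b y) // -rxy; apply: (FP _).2 => //; first exact: inC.
by rewrite rxy; exact: inC.
Qed.

End Conflicts.

(** * From list colourings to the strong list-chromatic index *)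

Section Lists.

Import boolp classical_sets functions cardinality.

Lemma card_le_seq (C : Type) (A : set C) n : (`I_n #<= A)%card ->
  exists s : seq {classic C}, [/\ uniq s, size s = n & forall x, x \in s -> A x].
Proof.
move=> /card_leP[f].
pose g (i : 'I_n) : {classic C} := val (f (SigSub (mem_set (ltn_ord i : `I_n i)))).
have g_inj : injective g.
  move=> i j /val_inj /(@inj _ _ _ f) => /(_ (in_setT _) (in_setT _)) [].
  exact: ord_inj.
exists [seq g i | i <- enum 'I_n]; split.
- by rewrite map_inj_uniq ?enum_uniq.
- by rewrite size_map size_enum_ord.
- by move=> x /mapP[i _ ->]; exact: set_valP.
Qed.

Lemma subcubic_strongly_choosable (G : sgraph) :
  max_degree G <= 3 -> strongly_choosable G 11.
Proof.
move=> hG C L cardL.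
have deg3 (x : G) : #|nbr x| <= 3.
  rewrite cardsE; apply: leq_trans hG.
  exact: (leq_bigmax (F := fun x : G => #|[pred y | adj x y]|)).
case: (pickP (@predT (edge G))) => [e0 _|noE]; last first.
  have abs (e : edge G) : False by have := noE e.
  by exists (fun e => False_rect _ (abs e)); split=> [a|a]; case: (abs a).
have /choice[l lP] := fun e => card_le_seq (cardL e).
pose T : eqType := {classic C}.
have x0 : T.
  by have [_ + _] := lP e0; case: (l e0) => // x s _; exact: x.
(* The lists are transported to vertex sets; non-edges get an empty list. *)
pose L' (e : {set G}) : seq T := if insub e is Some a then l a else [::].
have L'E (a : edge G) : L' (val a) = l a by rewrite /L' valK.
have L'u e : e \in edge_set G -> uniq (L' e).
  by move=> eE; rewrite -[e]/(val (Sub e eE : edge G)) L'E; have [] := lP (Sub e eE).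
have L's e : e \in edge_set G -> size (L' e) = 11.
  by move=> eE; rewrite -[e]/(val (Sub e eE : edge G)) L'E; have [] := lP (Sub e eE).
have [c [cL cP]] := strong_list_coloring deg3 x0 L'u L's.
exists (fun e => c (val e)); split=> [a b ab H|a]; last first.
  by have [_ _] := lP a; apply; rewrite -L'E; apply: cL; exact: valP.
suff : conf (val a) (val b) by move/(cP _ _ (valP a) (valP b))/eqP.
apply/confP; split; first by rewrite (inj_eq val_inj).
have meet (u v : edge G) : edge_adj u v -> exists2 x, x \in val u & x \in val v.
  by case/andP=> _ /set0Pn[x /setIP[]]; exists x.
case/orP: H => [/meet[x xa xb]|/existsP[d /andP[/meet[x xa xd] /meet[y yb yd]]]].
  by exists x, x; rewrite eqxx.
exists x, y; split=> //.
have /edgeP[p [q [pq dE]]] := valP d; move: xd yd; rewrite dE !inE.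
have qp : adj q p by rewrite adj_sym.
by case/orP=> /eqP-> /orP[]/eqP->; rewrite ?eqxx ?pq ?qp ?orbT.
Qed.

End Lists.

Theorem theorem1p2 (G : sgraph) (hG : max_degree G <= 3) :
  strong_list_chromatic_index G <= 11.
Proof.
rewrite /strong_list_chromatic_index; case: ex_minnP => m _; apply => /=.
exact/boolp.asboolP/subcubic_strongly_choosable.
Qed.
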